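(* Let $(\mathfrak g,[-,-],(-)^{[p]},R)$ be a restricted Rota-Baxter Lie algebra of weight $\lambda\in\mathbf k$, and let $\mathfrak g_R=(\mathfrak g,[-,-]_R)$ with $[x,y]_R=[R(x),y]+[x,R(y)]+\lambda[x,y]$ be its descendent Lie algebra. Then $(\mathfrak g_R,(-)^{[p]_R},R)$ is again a restricted Rota-Baxter Lie algebra of weight $\lambda$ (the descendent restricted Rota-Baxter Lie algebra). Hence $R$ is a homomorphism of restricted Rota-Baxter Lie algebras from $(\mathfrak g_R,(-)^{[p]_R},R)$ to $(\mathfrak g,[-,-],(-)^{[p]},R)$.
   Context: Convention: $\mathbf k$ is an algebraically closed field of prime characteristic $p$; everything is over $\mathbf k$. Restricted Lie algebra: a Lie algebra $(\mathfrak g,[-,-])$ with a $p$-map $(-)^{[p]}:\mathfrak g\to\mathfrak g$ satisfying $(ax)^{[p]}=a^px^{[p]}$ for $a\in\mathbf k$, $[x^{[p]},y]=(\mathrm{ad}_x)^p(y)$, and $(x+y)^{[p]}=x^{[p]}+y^{[p]}+\sum_{i=1}^{p-1}s_i(x,y)$, where $i\,s_i(x,y)$ is the coefficient of $t^{i-1}$ in $(\mathrm{ad}_{tx+y})^{p-1}(x)\in\mathbf k[t]\otimes\mathfrak g$. For a composition $\alpha=(\alpha_1,\dots,\alpha_r)\vDash n$ (a tuple of positive integers with sum $n$, of length $\ell(\alpha)=r$), $C_\alpha=\prod_{k=1}^r\binom{\alpha_1+\cdots+\alpha_k-1}{\alpha_k-1}$. A restricted Rota-Baxter Lie algebra $(\mathfrak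 g,[-,-],(-)^{[p]},R)$ of weight $\lambda$ is a restricted Lie algebra with a linear map $R$ such that $[R(x),R(y)]=R([R(x),y])+R([x,R(y)])+\lambda R([x,y])$ (Rota-Baxter operator of weight $\lambda$) and $R(x^{[p]_R})=R(x)^{[p]}$ for all $x,y\in\mathfrak g$, where, with $x\rhd_Ry:=[R(x),y]$ and $x^{\rhd_Rk}:=x\rhd_R(x\rhd_R\cdots(x\rhd_Rx)\cdots)$ ($k$ copies of $x$, $x^{\rhd_R1}=x$), $$x^{[p]_R}:=\lambda^{p-1}x^{[p]}+\sum_{r=1}^{p-1}\frac1r\lambda^{r-1}\sum_{\alpha\vDash p,\ \ell(\alpha)=r}C_\alpha\,[x^{\rhd_R\alpha_1},[x^{\rhd_R\alpha_2},[\cdots[x^{\rhd_R\alpha_{r-1}},x^{\rhd_R\alpha_r}]\cdots]]]$$ ($\lambda^0=1$; $\frac1r$ is the inverse of $r$ modulo $p$). A homomorphism of restricted Rota-Baxter Lie algebras is a Lie algebra homomorphism commuting with the $p$-maps and with the Rota-Baxter operators. *)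

(* Defs.v *)
From mathcomp Require Import all_boot all_order all_algebra.

Set Implicit Arguments.
Unset Strict Implicit.
Unset Printing Implicit Defensive.

Import GRing.Theory.
Local Open Scope ring_scope.

Record is_lie_algebra (k : fieldType) (g : lmodType k) (br : g -> g -> g) :
    Prop := IsLieAlgebra {
  lie_linearl : forall y, linear (br^~ y);
  lie_linearr : forall x, linear (br x);
  lie_alternating : forall x, br x x = 0;
  lie_jacobi : forall x y z,
    br x (br y z) + br y (br z x) + br z (br x y) = 0
}.

(* An element of k[t] (x) g is represented by its sequence of coefficients
   f : nat -> g, standing for \sum_i t^i (x) f i; finiteness of the support
   is not imposed, so this is really g[[t]], which contains k[t] (x) g as a
   Lie subalgebra. *)
Definition poly_br (k : fieldType) (g : lmodType k) (br : g -> g -> g)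
    (f h : nat -> g) : nat -> g :=
  fun n => \sum_(i < n.+1) br (f i) (h (n - i)%N).

Definition poly_const (k : fieldType) (g : lmodType k) (x : g) : nat -> g :=
  fun n => if n is n'.+1 then 0 else x.

(* t x + y *)
Definition poly_lin (k : fieldType) (g : lmodType k) (x y : g) : nat -> g :=
  fun n => match n with 0%N => y | 1%N => x | _ => 0 end.

Definition jacobson_s (k : fieldType) (p : nat) (g : lmodType k)
    (br : g -> g -> g) (i : nat) (x y : g) : g :=
  (i%:R : k)^-1 *:
    iter p.-1 (poly_br br (poly_lin x y)) (poly_const x) i.-1.

Record is_restricted_lie_algebra (k : fieldType) (p : nat) (g : lmodType k)
    (br : g -> g -> g) (pm : g -> g) : Prop := IsRestrictedLieAlgebra {
  restricted_lie : is_lie_algebra br;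
  pmapZ : forall (a : k) (x : g), pm (a *: x) = a ^+ p *: pm x;
  pmap_ad : forall x y, br (pm x) y = iter p (br x) y;
  pmapD : forall x y,
    pm (x + y) = pm x + pm y + \sum_(1 <= i < p) jacobson_s p br i x y
}.

Definition is_rota_baxter (k : fieldType) (g : lmodType k) (lam : k)
    (br : g -> g -> g) (R : g -> g) : Prop :=
  forall x y,
    br (R x) (R y) = R (br (R x) y) + R (br x (R y)) + lam *: R (br x y).

(* Every part of a composition of n is at most n, so compositions of n of
   length r are tuples in (r.-tuple 'I_n.+1). *)
Definition is_composition (n : nat) (a : seq nat) : bool :=
  all (fun m => 0 < m)%N a && (sumn a == n).

Definition comp_coef (a : seq nat) : nat :=
  (\prod_(i < size a) 'C((sumn (take i.+1 a)).-1, (nth 0 a i).-1))%N.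

(* x |>_R (x |>_R ( ... (x |>_R x))), n copies of x, for n > 0 *)
Definition rhd_pow (g : Type) (br : g -> g -> g) (R : g -> g)
    (n : nat) (x : g) : g :=
  iter n.-1 (br (R x)) x.

(* [x_1, [x_2, [ ... [x_(r-1), x_r]]]] for r > 0; it is x_1 when r = 1 *)
Fixpoint nested_br (k : fieldType) (g : lmodType k) (br : g -> g -> g)
    (s : seq g) : g :=
  match s with
  | [::] => 0
  | [:: x] => x
  | x :: s' => br x (nested_br br s')
  end.

Definition desc_pmap (k : fieldType) (p : nat) (g : lmodType k) (lam : k)
    (br : g -> g -> g) (pm : g -> g) (R : g -> g) (x : g) : g :=
  lam ^+ p.-1 *: pm x +
  \sum_(1 <= r < p) ((r%:R : k)^-1 * lam ^+ r.-1) *: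
    \sum_(t : r.-tuple 'I_p.+1 | is_composition p (map val t))
      nested_br br [seq rhd_pow br R m x | m <- map val t]
        *+ comp_coef (map val t).

Record is_restricted_rota_baxter (k : fieldType) (p : nat) (g : lmodType k)
    (lam : k) (br : g -> g -> g) (pm : g -> g) (R : g -> g) :
    Prop := IsRestrictedRotaBaxter {
  rrb_restricted : is_restricted_lie_algebra p br pm;
  rrb_linear : linear R;
  rrb_rota_baxter : is_rota_baxter lam br R;
  rrb_pmap : forall x, R (desc_pmap p lam br pm R x) = pm (R x)
}.

Definition desc_br (k : fieldType) (g : lmodType k) (lam : k)
    (br : g -> g -> g) (R : g -> g) (x y : g) : g :=
  br (R x) y + br x (R y) + lam *: br x y.

Record is_restricted_rota_baxter_hom (k : fieldType) (g h : lmodType k)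
    (brg : g -> g -> g) (pmg : g -> g) (Rg : g -> g)
    (brh : h -> h -> h) (pmh : h -> h) (Rh : h -> h) (f : g -> h) :
    Prop := IsRestrictedRotaBaxterHom {
  hom_linear : linear f;
  hom_br : forall x y, f (brg x y) = brh (f x) (f y);
  hom_pmap : forall x, f (pmg x) = pmh (f x);
  hom_rb : forall x, f (Rg x) = Rh (f x)
}.

(* Main.v *)
Require Import Defs.
From mathcomp Require Import all_boot all_order all_algebra.
From mathcomp Require Import boolp functions.

(* Write S(x, y) for the sum of the Jacobson polynomials s_i(x, y).  The 1-form
   u |-> (ad u)^(p-1) behaves like the differential of u^p: it is closed, by the
   Leibniz rule and p | C(p, i).  Integrating it along t x + y gives, for every
   derivation d of a Lie algebra in characteristic p,
     d S(x, y) = (ad (x+y))^(p-1) (d (x+y)) - (ad x)^(p-1) (d x)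
                 - (ad y)^(p-1) (d y).
   With d = ad z this is the formula for ad S(x, y); with d = d/dt on g[[t]] it
   shows that S is a symmetric 2-cocycle, with no recourse to enveloping
   algebras.  Hence a Lie algebra that is a direct sum of two subspaces with
   compatible partial p-maps is restricted.  This applies to the semidirect
   product of (g, lam [-,-]) by g, where x |-> (x, R x) embeds g_R; the p-map of
   the semidirect product at (x, R x) has first component x^{[p]_R}, because
   expanding (ad (t x + R x))^(p-1) x produces noncommutative Bell polynomials,
   whose coefficients are the C_alpha. *)

Set Implicit Arguments.
Unset Strict Implicit.
Unset Printing Implicit Defensive.

Import GRing.Theory.
Local Open Scope ring_scope.

(** * Linear maps and elementary bracket identities *)

Section LinearFun.
Variables (k : fieldType) (g h : lmodType k) (f : g -> h).
Hypothesis f_linear : linear f.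

Lemma linear_funD x y : f (x + y) = f x + f y.
Proof. by have := f_linear 1 x y; rewrite !scale1r. Qed.

Lemma linear_fun0 : f 0 = 0.
Proof. by apply: (addrI (f 0)); rewrite -linear_funD !addr0. Qed.

Lemma linear_funZ a x : f (a *: x) = a *: f x.
Proof. by have := f_linear a x 0; rewrite !addr0 linear_fun0 addr0. Qed.

Lemma linear_fun_sum (I : Type) (r : seq I) (P : pred I) F :
  f (\sum_(i <- r | P i) F i) = \sum_(i <- r | P i) f (F i).
Proof. exact: (big_morph f linear_funD linear_fun0). Qed.

End LinearFun.

Section LieAlgebra.
Variables (k : fieldType) (g : lmodType k) (br : g -> g -> g).
Hypothesis lie_br : is_lie_algebra br.

Lemma lie_brDl x y z : br (x + y) z = br x z + br y z.
Proof. exact: (linear_funD (lie_linearl lie_br z)). Qed.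

Lemma lie_brDr x y z : br x (y + z) = br x y + br x z.
Proof. exact: (linear_funD (lie_linearr lie_br x)). Qed.

Lemma lie_br0l x : br 0 x = 0.
Proof. exact: (linear_fun0 (lie_linearl lie_br x)). Qed.

Lemma lie_br0r x : br x 0 = 0.
Proof. exact: (linear_fun0 (lie_linearr lie_br x)). Qed.

Lemma lie_brZl a x y : br (a *: x) y = a *: br x y.
Proof. exact: (linear_funZ (lie_linearl lie_br y)). Qed.

Lemma lie_brZr a x y : br x (a *: y) = a *: br x y.
Proof. exact: (linear_funZ (lie_linearr lie_br x)). Qed.

Lemma lie_brNr x y : br x (- y) = - br x y.
Proof. by rewrite -scaleN1r lie_brZr scaleN1r. Qed.

Lemma lie_br_sumr (I : Type) (r : seq I) (P : pred I) F x :
  br x (\sum_(i <- r | P i) F i) = \sum_(i <- r | P i) br x (F i).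
Proof. exact: (linear_fun_sum (lie_linearr lie_br x)). Qed.

Lemma lie_brMnr n x y : br x (y *+ n) = br x y *+ n.
Proof. by rewrite -!scaler_nat lie_brZr. Qed.

Lemma lie_brMnl n x y : br (x *+ n) y = br x y *+ n.
Proof. by rewrite -!scaler_nat lie_brZl. Qed.

Lemma lie_anticomm x y : br x y = - br y x.
Proof.
apply/eqP; rewrite -addr_eq0; apply/eqP.
have := lie_alternating lie_br (x + y).
by rewrite lie_brDl !lie_brDr !(lie_alternating lie_br) add0r addr0.
Qed.

Lemma lie_leibniz x y z : br x (br y z) = br (br x y) z + br y (br x z).
Proof.
have := lie_jacobi lie_br x y z.
rewrite (lie_anticomm z x) lie_brNr (lie_anticomm z) -addrA => /eqP.
by rewrite addr_eq0 opprD !opprK addrC => /eqP ->.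
Qed.

Lemma iter_br0 n x : iter n (br x) 0 = 0.
Proof. by elim: n => //= n ->; rewrite lie_br0r. Qed.

Lemma iter_brN n x y : iter n (br x) (- y) = - iter n (br x) y.
Proof. by elim: n => //= n ->; rewrite lie_brNr. Qed.

Lemma iter_brZ n a x y : iter n (br x) (a *: y) = a *: iter n (br x) y.
Proof. by elim: n => //= n ->; rewrite lie_brZr. Qed.

End LieAlgebra.

(** * Derivations and the closedness of u |-> (ad u)^(p-1) *)

Record is_derivation (k : fieldType) (g : lmodType k) (br : g -> g -> g)
    (d : g -> g) : Prop := IsDerivation {
  der_linear : linear d;
  der_br : forall x y, d (br x y) = br (d x) y + br x (d y)
}.

Section Derivation.
Variables (k : fieldType) (g : lmodType k) (br : g -> g -> g).
Hypothesis lie_br : is_lie_algebra br.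

Section Basic.
Variable d : g -> g.
Hypothesis der_d : is_derivation br d.

Lemma der_iter_br n u v :
  d (iter n (br u) v) = iter n (br u) (d v) +
    \sum_(j < n) iter (n.-1 - j) (br u) (br (d u) (iter j (br u) v)).
Proof.
elim: n => [|n IHn]; first by rewrite big_ord0 addr0.
rewrite big_ord_recr /= subnn (der_br der_d) IHn (lie_brDr lie_br).
rewrite (lie_br_sumr lie_br) [LHS]addrC -addrA; congr (_ + (_ + _)).
by apply: eq_bigr => j _; case: n j {IHn} => [[]//|n] j; rewrite subSn // -ltnS.
Qed.

End Basic.

Lemma ad_derivation z : is_derivation br (br z).
Proof.
split; first exact: (lie_linearr lie_br).
by move=> x y; rewrite (lie_leibniz lie_br).
Qed.

(** Normal ordering: each [ad u] to the left of [ad v] either passes to its right or is absorbed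
    into [v], by one Leibniz rule per induction step; Pascal's rule merges the coefficients. *)
Lemma sum_iter_br n u v w :
  \sum_(j < n.+1) iter (n - j) (br u) (br v (iter j (br u) w)) =
  \sum_(c < n.+1)
    br (iter c (br u) v) (iter (n - c) (br u) w) *+ 'C(n.+1, c.+1).
Proof.
elim: n => [|n IHn]; first by rewrite !big_ord1 bin1.
rewrite big_ord_recr /= subnn.
have -> : \sum_(i < n.+1) iter (n.+1 - i) (br u) (br v (iter i (br u) w)) =
          br u (\sum_(j < n.+1) iter (n - j) (br u) (br v (iter j (br u) w))).
  rewrite (lie_br_sumr lie_br); apply: eq_bigr => j _.
  by rewrite subSn // -ltnS.
rewrite IHn (lie_br_sumr lie_br).
under [X in X + _]eq_bigr => c _ do
  rewrite (lie_brMnr lie_br) (lie_leibniz lie_br) mulrnDl.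
rewrite big_split /=.
under [RHS]eq_bigr => c _ do rewrite binS mulrnDr.
rewrite big_split /= [X in _ = X + _]big_ord_recr /= (bin_small (leqnn _)).
rewrite mulr0n addr0.
rewrite [X in _ = _ + X]big_ord_recl /= bin0 mulr1n.
rewrite -[LHS]addrA [LHS]addrC -[LHS]addrA.
congr (_ + (_ + _)); apply: eq_bigr => c _; first by rewrite subSn // -ltnS.
Qed.

Variable p : nat.
Hypothesis char_k : p \in [pchar k].

Lemma mulrn_bin_pchar (x : g) i : (0 < i < p)%N -> x *+ 'C(p, i) = 0.
Proof.
move=> i_p; have p_pr := pcharf_prime char_k.
rewrite -scaler_nat; have /dvdnP[m ->] := prime_dvd_bin p_pr i_p.
by rewrite natrM (pcharf0 char_k) mulr0 scale0r.
Qed.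

(* Closedness of the 1-form [v |-> (ad u)^(p-1) v], the formal differential of
   [u^p]. *)
Lemma ad_pred_closed d d' u :
    is_derivation br d -> is_derivation br d' -> d (d' u) = d' (d u) ->
  d (iter p.-1 (br u) (d' u)) = d' (iter p.-1 (br u) (d u)).
Proof.
move=> der_d der_d' dd'; rewrite !der_iter_br // dd'; congr (_ + _).
have p_gt1 := prime_gt1 (pcharf_prime char_k).
have mulC := mulrn_bin_pchar.
case: p p_gt1 mulC => [//|[//|n]] _ mulC /=.
(* Reversing one sum matches the terms of both sides up to sign; the coefficients ['C(n.+1, c)] and
   ['C(n.+1, c.+1)] add up to ['C(n.+2, c.+1)], where [n.+2] is the characteristic. *)
rewrite !sum_iter_br (reindex_inj rev_ord_inj) /=.
apply/eqP; rewrite -subr_eq0 -sumrB; apply/eqP/big1 => c _.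
have le_cn : (c <= n)%N by rewrite -ltnS.
rewrite !subSS subKn // (lie_anticomm lie_br) mulNrn -opprD -mulrnDr.
rewrite -subSn // bin_sub ?(leqW le_cn) // addnC -binS.
by rewrite mulC ?oppr0.
Qed.

End Derivation.

(** * Power series with coefficients in a Lie algebra *)

Section PowerSeries.
Variables (k : fieldType) (g : lmodType k) (br : g -> g -> g).
Hypothesis lie_br : is_lie_algebra br.

Implicit Types f h : nat -> g.

Lemma poly_brE f h n N : (n < N)%N ->
  poly_br br f h n =
  \sum_(i < N) \sum_(j < N) if (i + j == n)%N then br (f i) (h j) else 0.
Proof.
move=> lt_nN; rewrite /poly_br.
rewrite (big_ord_widen N (fun i => br (f i) (h (n - i)%N))) //.
rewrite big_mkcond; apply: eq_bigr => i _ /=; rewrite ltnS.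
rewrite -big_mkcond /=; case: leqP => [le_in|lt_ni]; last first.
  rewrite big1 // => j /eqP def_n; move: lt_ni.
  by rewrite -def_n ltnNge leq_addr.
have lt_niN : (n - i < N)%N by apply: leq_ltn_trans (leq_subr _ _) _.
rewrite (bigD1 (Ordinal lt_niN)) /= ?subnKC // big1 ?addr0 // => j.
case/andP=> /eqP def_n /eqP[]; apply/val_inj.
by rewrite /= -def_n addKn.
Qed.

Lemma poly_br_brE f1 f2 f3 n : poly_br br f1 (poly_br br f2 f3) n =
  \sum_(i < n.+1) \sum_(j < n.+1) \sum_(l < n.+1)
    if (i + j + l == n)%N then br (f1 i) (br (f2 j) (f3 l)) else 0.
Proof.
apply: eq_bigr => i _; have le_in : (i <= n)%N by rewrite -ltnS.
rewrite (@poly_brE _ _ _ n.+1) ?ltnS ?leq_subr // (lie_br_sumr lie_br).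
apply: eq_bigr => j _; rewrite (lie_br_sumr lie_br).
apply: eq_bigr => l _; rewrite -(eqn_add2l i) subnKC // addnA.
by case: eqP => // _; rewrite lie_br0r.
Qed.

(** The diagonal has a hypothesis of its own because antisymmetry does not kill it in characteristic
    2. *)
Lemma sum_alternating N (G : nat -> nat -> g) :
    (forall i, G i i = 0) -> (forall i j, G i j = - G j i) ->
  \sum_(i < N) \sum_(j < N) G i j = 0.
Proof.
move=> Gii Gij; elim: N => [|N IHN]; first by rewrite big_ord0.
rewrite big_ord_recr /=.
under eq_bigr => i _ do rewrite big_ord_recr /=.
rewrite big_split /= IHN add0r big_ord_recr /= Gii addr0 -big_split big1 //.
by move=> i _ /=; rewrite Gij addNr.
Qed.

Lemma poly_lie : is_lie_algebra (poly_br br).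
Proof.
split=> [h a f1 f2|f a h1 h2|f|f1 f2 f3]; apply: funext => n; rewrite ?fctE.
- rewrite /= /poly_br scaler_sumr -big_split; apply: eq_bigr => i _ /=.
  by rewrite (lie_linearl lie_br).
- rewrite /poly_br scaler_sumr -big_split; apply: eq_bigr => i _ /=.
  by rewrite (lie_linearr lie_br).
- rewrite (poly_brE _ _ (ltnSn n)).
  apply: (sum_alternating n.+1
    (G := fun i j => if (i + j == n)%N then br (f i) (f j) else 0)) => [i|i j].
    by rewrite (lie_alternating lie_br) if_same.
  by rewrite addnC; case: eqP => _; rewrite ?oppr0 // (lie_anticomm lie_br).
- rewrite !poly_br_brE.
  under [X in _ + X + _]eq_bigr => j _ do rewrite exchange_big /=.
  rewrite [X in _ + X + _]exchange_big [X in _ + X]exchange_big /=.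
  under [X in _ + X]eq_bigr => i _ do rewrite exchange_big /=.
  rewrite -!big_split big1 // => i _; rewrite -!big_split big1 // => j _.
  rewrite -!big_split big1 // => l _ /=.
  rewrite (addnC (j + l)%N) -(addnA l i j) (addnC l) addnA.
  by case: eqP => _; rewrite ?addr0 ?(lie_jacobi lie_br).
Qed.

Definition poly_der f : nat -> g := fun n => f n.+1 *+ n.+1.

Definition poly_map (d : g -> g) f : nat -> g := fun n => d (f n).

Lemma poly_der_derivation : is_derivation (poly_br br) poly_der.
Proof.
split=> [a f1 f2|f h]; apply: funext => n; rewrite ?fctE /poly_der.
  by rewrite mulrnDl scalerMnr.
rewrite /poly_br -sumrMnl /=.
have split_n (i : 'I_n.+2) : br (f i) (h (n.+1 - i)%N) *+ n.+1 =
    br (f i *+ i) (h (n.+1 - i)%N) + br (f i) (h (n.+1 - i)%N *+ (n.+1 - i)).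
  rewrite (lie_brMnl lie_br) (lie_brMnr lie_br) -mulrnDr.
  by rewrite subnKC // -ltnS.
under eq_bigr => i _ do rewrite split_n.
rewrite big_split /=; congr (_ + _).
  by rewrite big_ord_recl /= mulr0n (lie_br0l lie_br) add0r.
rewrite big_ord_recr /= subnn mulr0n (lie_br0r lie_br) addr0.
by apply: eq_bigr => i _; rewrite subSn // -ltnS.
Qed.

Lemma poly_map_derivation d :
  is_derivation br d -> is_derivation (poly_br br) (poly_map d).
Proof.
move=> der_d; split=> [a f1 f2|f h]; apply: funext => n;
  rewrite ?fctE /poly_map.
  exact: (der_linear der_d).
rewrite (linear_fun_sum (der_linear der_d)) -big_split; apply: eq_bigr => i _.
by rewrite (der_br der_d).
Qed.

Lemma poly_map_der d f :
  is_derivation br d -> poly_map d (poly_der f) = poly_der (poly_map d f).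
Proof.
move=> der_d; apply: funext => n; rewrite /poly_map /poly_der.
by rewrite -!scaler_nat (linear_funZ (der_linear der_d)).
Qed.

Lemma poly_der_lin x y : poly_der (poly_lin x y) = poly_const x.
Proof. by apply: funext => -[|n] //; rewrite /poly_der /= mul0rn. Qed.

Lemma poly_map_lin d x y :
  is_derivation br d -> poly_map d (poly_lin x y) = poly_lin (d x) (d y).
Proof.
move=> der_d; apply: funext => -[|[|n]] //.
by rewrite /poly_map /= (linear_fun0 (der_linear der_d)).
Qed.

Lemma poly_br_linE x y f n :
  poly_br br (poly_lin x y) f n =
  br y (f n) + if n is m.+1 then br x (f m) else 0.
Proof.
rewrite /poly_br big_ord_recl subn0; congr (_ + _).
case: n => [|n]; first by rewrite big_ord0.
rewrite big_ord_recl big1 => [|i _]; first by rewrite addr0 /bump /= subn1.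
by rewrite (lie_br0l lie_br).
Qed.

Definition poly_eval N (s : k) f y :=
  (forall i, (N <= i)%N -> f i = 0) /\ \sum_(i < N) s ^+ i *: f i = y.

Lemma poly_eval_ad N s f y a b : poly_eval N s f y ->
  poly_eval N.+1 s (poly_br br (poly_lin a b) f) (br (s *: a + b) y).
Proof.
case=> fN <-; split=> [[|i] // leNi|].
  by rewrite poly_br_linE !fN ?(lie_br0r lie_br) ?addr0 // leqW.
under eq_bigr => i _ do rewrite poly_br_linE scalerDr.
rewrite big_split /= [X in X + _]big_ord_recr /= (fN N) // (lie_br0r lie_br).
rewrite scaler0 addr0 big_ord_recl /= scaler0 add0r.
rewrite (lie_brDl lie_br) !(lie_br_sumr lie_br) addrC; congr (_ + _).
  apply: eq_bigr => i _; rewrite (lie_brZl lie_br) (lie_brZr lie_br).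
  by rewrite scalerA exprS.
by apply: eq_bigr => i _; rewrite (lie_brZr lie_br).
Qed.

Lemma poly_eval_lin s a b : poly_eval 2 s (poly_lin a b) (s *: a + b).
Proof.
split=> [[|[|i]] //|].
by rewrite big_ord_recl big_ord1 /= scale1r expr1 addrC.
Qed.

Lemma poly_eval0 N s : poly_eval N s 0 0.
Proof. by split=> // ; rewrite big1 // => i _; rewrite scaler0. Qed.

Lemma poly_evalD N s f h y z : poly_eval N s f y -> poly_eval N s h z ->
  poly_eval N s (f + h) (y + z).
Proof.
case=> fN <- [hN <-]; split=> [i leNi|]; first by rewrite fctE fN ?hN ?addr0.
by rewrite -big_split; apply: eq_bigr => i _; rewrite fctE scalerDr.
Qed.

Lemma poly_evalZ N s a f y : poly_eval N s f y ->
  poly_eval N s (a *: f) (a *: y).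
Proof.
case=> fN <-; split=> [i leNi|]; first by rewrite fctE fN ?scaler0.
by rewrite scaler_sumr; apply: eq_bigr => i _; rewrite fctE !scalerA mulrC.
Qed.

Lemma poly_eval_sum N s (I : Type) (r : seq I) (P : pred I) F G :
    (forall i, P i -> poly_eval N s (F i) (G i)) ->
  poly_eval N s (\sum_(i <- r | P i) F i) (\sum_(i <- r | P i) G i).
Proof.
move=> FG; elim/big_rec2: _ => [|i y f Pi fy]; first exact: poly_eval0.
by apply: poly_evalD => //; exact: FG.
Qed.

Lemma poly_eval_iter_lin n s x y a b :
  poly_eval n.+2 s (iter n (poly_br br (poly_lin x y)) (poly_lin a b))
    (iter n (br (s *: x + y)) (s *: a + b)).
Proof.
elim: n => [|n IHn]; first exact: poly_eval_lin.
exact: poly_eval_ad.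
Qed.

Lemma iter_poly_br_lin0 n x y f :
  iter n (poly_br br (poly_lin x y)) f 0 = iter n (br y) (f 0%N).
Proof. by elim: n => //= n IHn; rewrite poly_br_linE addr0 IHn. Qed.

Lemma iter_poly_br_lin_top n x y a b :
  iter n (poly_br br (poly_lin x y)) (poly_lin a b) n.+1 = iter n (br x) a.
Proof.
elim: n => //= n IHn; rewrite poly_br_linE IHn.
by rewrite (proj1 (poly_eval_iter_lin n 0 x y a b)) // (lie_br0r lie_br) add0r.
Qed.

End PowerSeries.

(** * Jacobson polynomials: derivations and the cocycle identity *)

Definition jacobson_sum (k : fieldType) (p : nat) (g : lmodType k)
    (br : g -> g -> g) (x y : g) : g :=
  \sum_(1 <= i < p) jacobson_s p br i x y.

Section JacobsonSum.
Variables (k : fieldType) (p : nat).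
Hypothesis char_k : p \in [pchar k].

Section OneAlgebra.
Variables (g : lmodType k) (br : g -> g -> g).
Hypothesis lie_br : is_lie_algebra br.

Lemma natr_pchar_neq0 i : (0 < i < p)%N -> i%:R != 0 :> k.
Proof.
case/andP=> i_gt0 lt_ip; rewrite -(dvdn_pcharf char_k).
by rewrite gtnNdvd.
Qed.

(** Closedness is applied to [poly_map d] and d/dt at t x + y: [d] of i s_i is the coefficient of
    t^(i-1) in a t-derivative, hence [i] times a coefficient of t^i, and [i] is invertible. *)
Lemma der_jacobson_s d i x y : is_derivation br d -> (0 < i < p)%N ->
  d (jacobson_s p br i x y) =
  iter p.-1 (poly_br br (poly_lin x y)) (poly_lin (d x) (d y)) i.
Proof.
move=> der_d i_p; have i_neq0 := natr_pchar_neq0 i_p.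
have der_t := poly_der_derivation lie_br.
have der_m := poly_map_derivation der_d.
have := ad_pred_closed (poly_lie lie_br) char_k der_m der_t
  (poly_map_der (poly_lin x y) der_d).
rewrite poly_der_lin (poly_map_lin _ _ der_d) => /(congr1 (@^~ i.-1)).
rewrite /jacobson_s (linear_funZ (der_linear der_d)) {1}/poly_map => ->.
case: i i_p i_neq0 => //= i _ i_neq0; rewrite /poly_der -scaler_nat scalerA.
by rewrite mulVf // scale1r.
Qed.

(** By [der_jacobson_s] the summands are the middle coefficients of one polynomial [F] of degree at
    most [p]; their sum is its value at t = 1 minus the constant and the top coefficient. *)
Lemma der_jacobson_sum d x y : is_derivation br d ->
  d (jacobson_sum p br x y) =
  iter p.-1 (br (x + y)) (d x + d y)
  - iter p.-1 (br x) (d x) - iter p.-1 (br y) (d y).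
Proof.
move=> der_d; rewrite /jacobson_sum (linear_fun_sum (der_linear der_d)).
under eq_big_nat => i i_p do rewrite (der_jacobson_s _ _ der_d) //.
have p_gt0 := prime_gt0 (pcharf_prime char_k).
have [_] := poly_eval_iter_lin lie_br p.-1 1 x y (d x) (d y).
set F := iter _ _ _ => evF; rewrite !scale1r in evF; rewrite -evF.
have -> : \sum_(i < p.-1.+2) 1 ^+ i *: F i = \sum_(0 <= i < p.+1) F i.
  rewrite big_mkord prednK //; apply: eq_bigr => i _.
  by rewrite expr1n scale1r.
have F0 : F 0%N = iter p.-1 (br y) (d y).
  by rewrite /F (iter_poly_br_lin0 lie_br).
have Fp : F p = iter p.-1 (br x) (d x).
  by rewrite -[in F p](prednK p_gt0) /F (iter_poly_br_lin_top lie_br).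
rewrite big_nat_recr //= [in RHS]big_ltn //.
by rewrite Fp F0 addrK [X in X - _]addrC addrK.
Qed.

Lemma ad_jacobson_sum x y z : br (jacobson_sum p br x y) z =
  iter p (br (x + y)) z - iter p (br x) z - iter p (br y) z.
Proof.
have p_gt0 := prime_gt0 (pcharf_prime char_k).
have ad_iter u : iter p.-1 (br u) (br z u) = - iter p (br u) z.
  by rewrite (lie_anticomm lie_br) (iter_brN lie_br) -iterSr prednK.
rewrite (lie_anticomm lie_br) (der_jacobson_sum _ _ (ad_derivation lie_br z)).
by rewrite -(lie_brDr lie_br) !ad_iter !opprD !opprK.
Qed.

Lemma iter_poly_br_linZ n a x y f i :
  iter n (poly_br br (poly_lin (a *: x) (a *: y))) f i =
  a ^+ n *: iter n (poly_br br (poly_lin x y)) f i.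
Proof.
elim: n i => [|n IHn] i /=; first by rewrite scale1r.
rewrite !(poly_br_linE lie_br) IHn exprS -scalerA.
rewrite (lie_brZl lie_br) (lie_brZr lie_br) !scalerDr; congr (_ + _).
case: i => [|i]; first by rewrite !scaler0.
by rewrite IHn (lie_brZl lie_br) (lie_brZr lie_br).
Qed.

Lemma jacobson_sumZ a x y :
  jacobson_sum p br (a *: x) (a *: y) = a ^+ p *: jacobson_sum p br x y.
Proof.
have p_gt0 := prime_gt0 (pcharf_prime char_k).
rewrite /jacobson_sum scaler_sumr; apply: eq_bigr => i _.
rewrite /jacobson_s iter_poly_br_linZ.
have -> : poly_const (a *: x) = a *: poly_const x.
  by apply: funext => -[|n]; rewrite fctE //= scaler0.
rewrite (iter_brZ (poly_lie lie_br)) fctE !scalerA.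
by rewrite -exprSr prednK // mulrC.
Qed.

Lemma jacobson_sum0l y : jacobson_sum p br 0 y = 0.
Proof.
rewrite /jacobson_sum big1 // => i _; rewrite /jacobson_s.
have -> : poly_const 0 = 0 :> (nat -> g) by apply: funext => -[|n].
by rewrite (iter_br0 (poly_lie lie_br)) scaler0.
Qed.

Lemma jacobson_sum0r x : jacobson_sum p br x 0 = 0.
Proof.
rewrite /jacobson_sum big1_seq // => i; rewrite mem_index_iota => /andP[_ i_p].
rewrite /jacobson_s.
have p_gt1 := prime_gt1 (pcharf_prime char_k).
have -> : iter p.-1 (poly_br br (poly_lin x 0)) (poly_const x) = 0.
  rewrite -[p.-1]prednK ?iterSr; last by rewrite -ltnS prednK // ltnW.
  rewrite (_ : poly_br br _ _ = 0) ?(iter_br0 (poly_lie lie_br)) //.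
  apply: funext => n; rewrite (poly_br_linE lie_br) (lie_br0l lie_br) add0r.
  by case: n => [|[|n]] //=;
    rewrite ?(lie_alternating lie_br) ?(lie_br0r lie_br).
by rewrite scaler0.
Qed.

(** Evaluation at [s] preserves brackets, so it commutes with Jacobson polynomials, whose own
    variable stays formal. The p - 1 brackets start from degree at most 1, whence the bound. *)
Lemma poly_eval_jacobson_sum s x1 x0 y1 y0 :
  poly_eval p.+1 s
    (jacobson_sum p (poly_br br) (poly_lin x1 x0) (poly_lin y1 y0))
    (jacobson_sum p br (s *: x1 + x0) (s *: y1 + y0)).
Proof.
have p_gt0 := prime_gt0 (pcharf_prime char_k).
apply: poly_eval_sum => i _; apply: poly_evalZ; move: (i.-1) => j.
have -> : p.+1 = (p.-1 + 2)%N by rewrite addn2 prednK.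
elim: p.-1 j => [|n IHn] j /=.
  case: j => [|j] /=; first exact: poly_eval_lin.
  exact: poly_eval0.
rewrite (poly_br_linE (poly_lie lie_br)) (poly_br_linE lie_br) addSn.
apply: poly_evalD; first exact: poly_eval_ad.
case: j => [|j]; first exact: poly_eval0.
exact: poly_eval_ad.
Qed.

End OneAlgebra.

(** Both groups of terms correct the expansion of (a + b + c + d)^p into p-th powers, with the pairs
    (a, c), (b, d) or (a, b), (c, d) added first. Its vanishing packs symmetry and the 2-cocycle
    identity into one equation. *)
Definition jacobson_defect (g : lmodType k) (br : g -> g -> g) (a b c d : g) :=
  jacobson_sum p br a c + jacobson_sum p br b d
  + jacobson_sum p br (a + c) (b + d)
  - (jacobson_sum p br a b + jacobson_sum p br c d
     + jacobson_sum p br (a + b) (c + d)).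

(** By [der_jacobson_sum], [der] turns each Jacobson sum into a coboundary of u |-> (ad u)^(p-1)
    (der u); both groupings telescope to the same value. *)
Lemma der_jacobson_defect (g : lmodType k) (br : g -> g -> g) der a b c d :
    is_lie_algebra br -> is_derivation br der ->
  der (jacobson_defect br a b c d) = 0.
Proof.
move=> lie_br der_d.
have d_linear := der_linear der_d.
rewrite /jacobson_defect -scaleN1r !(linear_funD d_linear).
rewrite (linear_funZ d_linear) !(linear_funD d_linear) scaleN1r.
rewrite !(der_jacobson_sum lie_br _ _ der_d) !(linear_funD d_linear).
have sumE (X Y Z A B C D : g) :
    X - A - C + (Y - B - D) + (Z - X - Y) = Z - (A + B + (C + D)).
  rewrite -(addrA X) -(addrA Y) -(addrA Z) -!opprD [X - _ + _]addrACA.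
  by rewrite [LHS]addrC [LHS]addrA subrK -opprD [A + C + _]addrACA.
rewrite !sumE [a + c + _]addrACA [der a + der c + _]addrACA.
by rewrite [X in _ - (_ - X)]addrACA subrr.
Qed.

Section Cocycle.
Variables (g : lmodType k) (br : g -> g -> g).
Hypothesis lie_br : is_lie_algebra br.

(* The coefficients of the defect along a line are killed by [d/dt], so that
   only the exponents [0] and [p] survive. *)
Lemma jacobson_defect_line a1 a0 b1 b0 c1 c0 d1 d0 : exists z0 zp, forall s : k,
  jacobson_defect br (s *: a1 + a0) (s *: b1 + b0) (s *: c1 + c0) (s *: d1 + d0)
  = z0 + s ^+ p *: zp.
Proof.
have p_gt0 := prime_gt0 (pcharf_prime char_k).
pose F := jacobson_defect (poly_br br) (poly_lin a1 a0) (poly_lin b1 b0)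
  (poly_lin c1 c0) (poly_lin d1 d0).
exists (F 0%N), (F p) => s.
have linD x1 x0 y1 y0 :
    poly_lin x1 x0 + poly_lin y1 y0 =
    poly_lin (x1 + y1) (x0 + y0) :> (nat -> g).
  by apply: funext => -[|[|n]]; rewrite fctE //= addr0.
have evD x1 x0 y1 y0 :
    s *: x1 + x0 + (s *: y1 + y0) = s *: (x1 + y1) + (x0 + y0).
  by rewrite addrACA scalerDr.
have [] : poly_eval p.+1 s F (jacobson_defect br (s *: a1 + a0) (s *: b1 + b0)
    (s *: c1 + c0) (s *: d1 + d0)).
  rewrite /F /jacobson_defect !linD !evD -![- (_ + _)]scaleN1r.
  do ![apply: poly_evalD || apply: poly_evalZ]; exact: poly_eval_jacobson_sum.
have F_mid i : (0 < i < p)%N -> F i = 0.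
  case: i => // i i_p.
  have /(congr1 (@^~ i)) : poly_der F = 0.
    apply: der_jacobson_defect; first exact: poly_lie.
    exact: poly_der_derivation.
  rewrite /poly_der -scaler_nat => /eqP; rewrite scaler_eq0.
  by rewrite (negPf (natr_pchar_neq0 i_p)) => /eqP.
move=> _ <-; rewrite big_ord_recr.
rewrite -(big_mkord xpredT (fun i => s ^+ i *: F i)) /=.
rewrite big_ltn // big_nat big1 => [|i i_p]; last by rewrite F_mid ?scaler0.
by rewrite addr0 scale1r.
Qed.

(** The defect vanishes for a = b = 0 and for c = d = 0, so [jacobson_defect_line] makes it
    homogeneous of degree [p] in (a, b) alone and in (c, d) alone. It is also homogeneous of degree
    [p] in all four together, so s^(2p) and s^p act alike on it; by injectivity of Frobenius s^p is
    not 1, and the defect is 0. *)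
Lemma jacobson_defect_eq0 a b c d :
  (exists2 s : k, s != 0 & s != 1) -> jacobson_defect br a b c d = 0.
Proof.
case=> s s_neq0 s_neq1; have p_gt0 := prime_gt0 (pcharf_prime char_k).
have scale_l a' b' c' d' : jacobson_defect br (s *: a') (s *: b') c' d' =
    s ^+ p *: jacobson_defect br a' b' c' d'.
  have [z0 [zp Fs]] := jacobson_defect_line a' 0 b' 0 0 c' 0 d'.
  have := Fs s; have := Fs 1; have := Fs 0.
  rewrite !scale0r !scale1r !scaler0 !(addr0, add0r) expr0n expr1n.
  rewrite (gtn_eqF p_gt0) scale0r scale1r addr0 => z0E -> ->.
  suff -> : z0 = 0 by rewrite !add0r.
  rewrite -z0E /jacobson_defect !(add0r, addr0) !(jacobson_sum0l lie_br).
  by rewrite !(add0r, addr0) subrr.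
have scale_r a' b' c' d' : jacobson_defect br a' b' (s *: c') (s *: d') =
    s ^+ p *: jacobson_defect br a' b' c' d'.
  have [z0 [zp Fs]] := jacobson_defect_line 0 a' 0 b' c' 0 d' 0.
  have := Fs s; have := Fs 1; have := Fs 0.
  rewrite !scale0r !scale1r !scaler0 !(addr0, add0r) expr0n expr1n.
  rewrite (gtn_eqF p_gt0) scale0r scale1r addr0 => z0E -> ->.
  suff -> : z0 = 0 by rewrite !add0r.
  rewrite -z0E /jacobson_defect !(add0r, addr0) !(jacobson_sum0r lie_br).
  by rewrite !(add0r, addr0) subrr.
have scale_lr : jacobson_defect br (s *: a) (s *: b) (s *: c) (s *: d) =
    s ^+ p *: jacobson_defect br a b c d.
  rewrite /jacobson_defect -!scalerDr !(jacobson_sumZ lie_br).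
  by rewrite -!scalerDr -scalerBr.
move: scale_lr; rewrite scale_l scale_r => /(scalerI (expf_neq0 p s_neq0))/eqP.
rewrite -[X in _ == X]scale1r -subr_eq0 -scalerBl scaler_eq0 subr_eq0.
case/orP => [|/eqP //].
rewrite -(rmorph1 (pFrobenius_aut char_k)) -pFrobenius_autE.
by rewrite (inj_eq (fmorph_inj _)) (negPf s_neq1).
Qed.

End Cocycle.

End JacobsonSum.

(** * Restricted structures on a sum of two subspaces *)

Section RestrictedDecomposition.
Variables (k : fieldType) (p : nat) (g : lmodType k) (br : g -> g -> g).
Hypothesis char_k : p \in [pchar k].
Hypothesis k_big : exists2 s : k, s != 0 & s != 1.
Hypothesis lie_br : is_lie_algebra br.

(** The subspace is given by [q], in use a projection, and [P] is a p-map on its image only; the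
    [ad] condition still ranges over all of [g]. *)
Record is_restricted_on (q P : g -> g) : Prop := IsRestrictedOn {
  on_linear : linear q;
  on_pmapZ : forall a z, P (a *: q z) = a ^+ p *: P (q z);
  on_pmap_ad : forall z w, br (P (q z)) w = iter p (br (q z)) w;
  on_pmapD : forall z w,
    P (q z + q w) = P (q z) + P (q w) + jacobson_sum p br (q z) (q w)
}.

(** The p-map is forced by z = q1 z + q2 z. Its [ad] condition comes from [ad_jacobson_sum], its
    additivity from the vanishing of the defect at the four components of [z] and [w]. *)
Lemma restricted_decomposition q1 q2 P1 P2 :
    is_restricted_on q1 P1 -> is_restricted_on q2 P2 ->
    (forall z, q1 z + q2 z = z) ->
  is_restricted_lie_algebra p br
    (fun z => P1 (q1 z) + P2 (q2 z) + jacobson_sum p br (q1 z) (q2 z)).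
Proof.
move=> [q1L P1Z P1ad P1D] [q2L P2Z P2ad P2D] q12; split=> //.
- move=> a z.
  rewrite !(linear_funZ q1L, linear_funZ q2L) P1Z P2Z.
  by rewrite (jacobson_sumZ char_k lie_br) !scalerDr.
- move=> z w; rewrite !(lie_brDl lie_br) P1ad P2ad.
  rewrite (ad_jacobson_sum char_k lie_br) q12 -[X in _ + X]addrA -opprD.
  by rewrite [LHS]addrC subrK.
- move=> z w; rewrite (linear_funD q1L) (linear_funD q2L) P1D P2D.
  have /eqP :=
    jacobson_defect_eq0 char_k lie_br (q1 z) (q2 z) (q1 w) (q2 w) k_big.
  rewrite /jacobson_defect subr_eq0 !q12 => /eqP SE.
  rewrite -/(jacobson_sum p br z w).
  have regroup (a b c d e1 e2 e3 : g) :
      a + b + e1 + (c + d + e2) + e3 = a + c + (b + d) + (e1 + e2 + e3).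
    by rewrite [a + b + e1 + _]addrACA -[LHS]addrA [a + b + _]addrACA.
  by rewrite !regroup SE [X in X + _]addrACA.
Qed.

End RestrictedDecomposition.

(** * Homomorphisms and pullback along an injection *)

Section Homomorphism.
Variables (k : fieldType) (p : nat) (g h : lmodType k).
Variables (brg : g -> g -> g) (brh : h -> h -> h) (f : g -> h).
Hypothesis f_linear : linear f.
Hypothesis f_br : forall x y, f (brg x y) = brh (f x) (f y).

Let fD := linear_funD f_linear.
Let fZ := linear_funZ f_linear.
Let f0 := linear_fun0 f_linear.

Lemma hom_poly_br u v i :
  poly_br brh (f \o u) (f \o v) i = f (poly_br brg u v i).
Proof.
by rewrite (big_morph f fD f0); apply: eq_bigr => j _; rewrite f_br.
Qed.

Lemma hom_jacobson_sum x y :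
  f (jacobson_sum p brg x y) = jacobson_sum p brh (f x) (f y).
Proof.
rewrite (big_morph f fD f0); apply: eq_bigr => i _; rewrite fZ; congr (_ *: _).
have -> : poly_lin (f x) (f y) = f \o poly_lin x y.
  by apply: funext => -[|[|n]].
have -> : poly_const (f x) = f \o poly_const x.
  by apply: funext => -[|n].
elim: p.-1 (i.-1) => //= n IHn j; rewrite -hom_poly_br.
by congr poly_br; apply: funext => l /=; rewrite IHn.
Qed.

Lemma hom_iter_br n x y : f (iter n (brg x) y) = iter n (brh (f x)) (f y).
Proof. by elim: n => //= n IHn; rewrite f_br IHn. Qed.

(** Every axiom is an identity that can be checked after the injection [f]. Even the Lie axioms of
    [brg] come out this way, which is how [desc_br] gets them. *)
Lemma restricted_pullback pmg pmh : injective f ->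
    is_restricted_lie_algebra p brh pmh -> (forall x, f (pmg x) = pmh (f x)) ->
  is_restricted_lie_algebra p brg pmg.
Proof.
move=> f_inj [lie_h pZ pad pD] f_pm; split.
- split=> [y a u v|x a u v|x|x y z]; apply: f_inj.
  + by rewrite f_linear !f_br f_linear (lie_brDl lie_h) (lie_brZl lie_h).
  + by rewrite f_linear !f_br f_linear (lie_brDr lie_h) (lie_brZr lie_h).
  + by rewrite f_br f0 (lie_alternating lie_h).
  + by rewrite !fD !f_br f0 (lie_jacobi lie_h).
- by move=> a x; apply: f_inj; rewrite f_pm !fZ pZ f_pm.
- by move=> x y; apply: f_inj; rewrite f_br f_pm pad hom_iter_br.
- move=> x y; apply: f_inj; rewrite -/(jacobson_sum p brg x y).
  by rewrite f_pm !fD pD !f_pm hom_jacobson_sum.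
Qed.

End Homomorphism.

(** * Rescaling the bracket *)

Section ScaledBracket.
Variables (k : fieldType) (p : nat) (g : lmodType k) (lam : k).
Variables (br : g -> g -> g) (pm : g -> g).
Hypothesis char_k : p \in [pchar k].

Definition scale_br (x y : g) : g := lam *: br x y.

Lemma scale_br_lie : is_lie_algebra br -> is_lie_algebra scale_br.
Proof.
move=> lie_br; rewrite /scale_br; split=> [y a u v|x a u v|x|x y z] /=.
- by rewrite (lie_linearl lie_br) scalerDr !scalerA mulrC.
- by rewrite (lie_linearr lie_br) scalerDr !scalerA mulrC.
- by rewrite (lie_alternating lie_br) scaler0.
- by rewrite !(lie_brZr lie_br) -!scalerDr (lie_jacobi lie_br) !scaler0.
Qed.

Lemma iter_scale_br n x y : is_lie_algebra br ->
  iter n (scale_br x) y = lam ^+ n *: iter n (br x) y.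
Proof.
move=> lie_br; elim: n => [|n IHn] /=; first by rewrite scale1r.
by rewrite IHn /scale_br (lie_brZr lie_br) scalerA exprS.
Qed.

Lemma iter_poly_scale_br n x y f i : is_lie_algebra br ->
  iter n (poly_br scale_br (poly_lin x y)) f i =
  lam ^+ n *: iter n (poly_br br (poly_lin x y)) f i.
Proof.
move=> lie_br; rewrite -(iter_poly_br_linZ lie_br).
congr (iter n _ f i); apply: funext => h; apply: funext => j.
apply: eq_bigr => -[[|[|l]] lt_lj] _;
  rewrite /scale_br /= ?(lie_brZl lie_br) //.
by rewrite (lie_br0l lie_br) scaler0.
Qed.

Lemma jacobson_sum_scale_br x y : is_lie_algebra br ->
  jacobson_sum p scale_br x y = lam ^+ p.-1 *: jacobson_sum p br x y.
Proof.
move=> lie_br; rewrite /jacobson_sum scaler_sumr; apply: eq_bigr => i _.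
by rewrite /jacobson_s iter_poly_scale_br // !scalerA mulrC.
Qed.

(** A Jacobson polynomial contains p - 1 brackets, so it scales by lam^(p-1) like the p-map; in the
    [ad] condition the outer bracket supplies the last factor of lam^p. *)
Lemma scale_br_restricted : is_restricted_lie_algebra p br pm ->
  is_restricted_lie_algebra p scale_br (fun x => lam ^+ p.-1 *: pm x).
Proof.
have p_gt0 := prime_gt0 (pcharf_prime char_k).
move=> [lie_br pZ pad pD]; split; first exact: scale_br_lie.
- by move=> a x; rewrite pZ !scalerA mulrC.
- move=> x y; rewrite iter_scale_br // /scale_br (lie_brZl lie_br) pad scalerA.
  by rewrite -exprS prednK.
- move=> x y; rewrite -/(jacobson_sum p scale_br x y) jacobson_sum_scale_br //.
  by rewrite pD !scalerDr.
Qed.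

End ScaledBracket.

(** * Compositions and noncommutative Bell polynomials *)

Lemma sum_pascal (V : nmodType) (G : nat -> nat -> V) m :
  \sum_(j < m.+1) (G j (m.+1 - j)%N + G j.+1 (m - j)%N) *+ 'C(m, j) =
  \sum_(j < m.+2) G j (m.+1 - j)%N *+ 'C(m.+1, j).
Proof.
under eq_bigr => j _ do rewrite mulrnDl.
rewrite big_split /= [RHS]big_ord_recl bin0 subn0.
under [X in _ = _ + X]eq_bigr => j _ do rewrite lift0 binS subSS mulrnDr.
rewrite big_split /= addrA; congr (_ + _).
rewrite big_ord_recl bin0 subn0; congr (_ + _).
by rewrite [RHS]big_ord_recr /= bin_small // mulr0n addr0.
Qed.

Lemma is_composition_rcons n s a : is_composition n (rcons s a) =
  (0 < a <= n)%N && is_composition (n - a) s.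
Proof.
rewrite /is_composition all_rcons sumn_rcons.
case: (0 < a)%N => //=; case: (all _ s) => /=; last by rewrite andbF.
case: leqP => [le_an|lt_na] /=.
  by rewrite -{1}(subnK le_an) eqn_add2r.
by apply/eqP => sum_n; move: lt_na; rewrite -sum_n ltnNge leq_addl.
Qed.

(** The factors of [comp_coef] depend on partial sums from the left, so dropping the last part drops
    exactly one factor. *)
Lemma comp_coef_rcons s a :
  comp_coef (rcons s a) = (comp_coef s * 'C((sumn s + a).-1, a.-1))%N.
Proof.
rewrite /comp_coef size_rcons big_ord_recr /= nth_rcons ltnn eqxx.
rewrite take_oversize ?size_rcons // sumn_rcons; congr (_ * _)%N.
by apply: eq_bigr => i _; rewrite nth_rcons ltn_ord -cats1 takel_cat.
Qed.

Lemma rcons_tuple_bij (T : finType) r :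
  bijective (fun ta : r.-tuple T * T => rcons_tuple ta.1 ta.2).
Proof.
apply: inj_card_bij => [[t a] [u b] /(congr1 val) /= /rcons_inj[tu ->]|].
  by congr pair; apply/val_inj.
by rewrite card_prod !card_tuple expnSr.
Qed.

(** Compositions are sorted by their last part i + 1. The bound [N] is kept apart from [n] so that
    the shorter compositions have entries in the same ['I_N]. *)
Lemma sum_composition_rcons (V : nmodType) (Phi : seq nat -> V) r n N :
  (n < N)%N ->
  \sum_(t : r.+1.-tuple 'I_N | is_composition n (map val t))
    Phi (map val t) *+ comp_coef (map val t) =
  \sum_(i < n)
    (\sum_(t : r.-tuple 'I_N | is_composition (n.-1 - i) (map val t))
      Phi (rcons (map val t) i.+1) *+ comp_coef (map val t)) *+ 'C(n.-1, i).
Proof.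
move=> lt_nN; rewrite (reindex _ (onW_bij _ (rcons_tuple_bij 'I_N r))) /=.
pose F a := if (0 < a <= n)%N then
  (\sum_(t : r.-tuple 'I_N | is_composition (n - a) (map val t))
    Phi (rcons (map val t) a) *+ comp_coef (map val t)) *+ 'C(n.-1, a.-1) else 0.
pose G (t : r.-tuple 'I_N) (a : 'I_N) :=
  let s := map val (rcons_tuple t a) in
  if is_composition n s then Phi s *+ comp_coef s else 0.
transitivity (\sum_(a < N) F a).
  rewrite big_mkcond -(pair_bigA _ G) exchange_big {}/G.
  apply: eq_bigr => a _; rewrite /F -big_mkcond /=.
  under eq_bigl => t do rewrite map_rcons is_composition_rcons.
  case: ifP => [/= /andP[a_gt0 le_an]|_]; last by rewrite big_pred0.
  rewrite -sumrMnl; apply: eq_bigr => t /andP[_ /eqP sum_t].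
  by rewrite map_rcons comp_coef_rcons sum_t subnK // mulrnA.
rewrite -(big_mkord xpredT) (@big_cat_nat _ _ _ n.+1) //=.
rewrite [X in _ + X]big_nat [X in _ + X]big1 => [|a].
  rewrite addr0 big_nat_recl // {1}/F add0r big_mkord; apply: eq_bigr => i _.
  rewrite /F ltn_ord /=.
  by have -> : (n - i.+1 = n.-1 - i)%N by rewrite -subn1 -subnDA.
by case/andP=> lt_na _; rewrite /F (leqNgt a) lt_na andbF.
Qed.

Section NoncommutativeBell.
Variables (k : fieldType) (g : lmodType k) (br : g -> g -> g) (x u : g).
Hypothesis lie_br : is_lie_algebra br.

(* The part of degree [r] in [x] of the [n]-th noncommutative Bell polynomial
   in the [ad ((ad u)^i x)], applied to [y]; the recursion is on the last part
   of the compositions. *)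
Fixpoint bell r n y : g :=
  if r is r'.+1 then
    \sum_(i < n) bell r' (n.-1 - i)%N (br (iter i (br u) x) y) *+ 'C(n.-1, i)
  else if n is 0%N then y else 0.

Lemma bellD r n y z : bell r n (y + z) = bell r n y + bell r n z.
Proof.
elim: r n y z => [|r IHr] n y z /=; first by case: n => *; rewrite ?addr0.
rewrite -big_split; apply: eq_bigr => i _ /=.
by rewrite (lie_brDr lie_br) IHr mulrnDl.
Qed.

(** With B_n the polynomial in t whose coefficients are the [bell r n], this is the coefficient of
    t^r in ad (t x + u) B_n = B_(n+1) + B_n (ad u). In the induction on [r], [ad u] either raises
    the exponent in an (ad u)^i x or moves on towards [y]. *)
Lemma bell_recursion r n y :
  br u (bell r n y) + (if r is r'.+1 then br x (bell r' n y) else 0) =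
  bell r n.+1 y + bell r n (br u y).
Proof.
elim: r n y => [|r IHr] n y.
  by case: n => [|n] /=; rewrite addr0 add0r ?(lie_br0r lie_br).
case: n => [|n].
  rewrite /= !big_ord0 (lie_br0r lie_br) add0r addr0 big_ord1 /= mulr1n.
  by case: r {IHr} => [|r] //=; rewrite !big_ord0 (lie_br0r lie_br).
rewrite -[bell r.+1 n.+2 y]/(\sum_(i < n.+2)
  bell r (n.+1 - i)%N (br (iter i (br u) x) y) *+ 'C(n.+1, i)).
rewrite -(sum_pascal (fun i l => bell r l (br (iter i (br u) x) y))) /=.
rewrite (lie_br_sumr lie_br) -big_split /=.
transitivity (\sum_(i < n.+1)
  (br u (bell r (n - i)%N (br (iter i (br u) x) y)) +
  (if r is r'.+1 then br x (bell r' (n - i)%N (br (iter i (br u) x) y)) else 0))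
     *+ 'C(n, i)).
  under [RHS]eq_bigr => i _ do rewrite mulrnDl.
  rewrite big_split /=; congr (_ + _).
    by apply: eq_bigr => i _; rewrite (lie_brMnr lie_br).
  case: r {IHr} => [|r] /=.
    by rewrite big1 ?(lie_br0r lie_br) // => i _; rewrite mul0rn.
  rewrite (lie_br_sumr lie_br); apply: eq_bigr => i _.
  by rewrite (lie_brMnr lie_br).
apply: eq_bigr => i _; rewrite IHr -mulrnDl; congr (_ *+ _).
have le_in : (i <= n)%N by rewrite -ltnS.
by rewrite subSn // (lie_leibniz lie_br) bellD addrA.
Qed.

(** The power (ad (t x + u))^m is expanded by the number [j] of factors [ad u] that act on [y]
    itself; each step is [bell_recursion] with Pascal's rule. *)
Lemma iter_poly_br_bell m r y :
  iter m (poly_br br (poly_lin x u)) (poly_const y) r =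
  \sum_(j < m.+1) bell r (m - j)%N (iter j (br u) y) *+ 'C(m, j).
Proof.
elim: m r => [|m IHm] r.
  by rewrite big_ord1 /= mulr1n; case: r => [|r] //=; rewrite big_ord0.
rewrite iterS (poly_br_linE lie_br).
rewrite -(sum_pascal (fun j l => bell r l (iter j (br u) y))) IHm.
under [RHS]eq_bigr => j _.
  have le_jm : (j <= m)%N by rewrite -ltnS.
  rewrite subSn //= -bell_recursion mulrnDl; over.
rewrite big_split /= (lie_br_sumr lie_br); congr (_ + _).
  by apply: eq_bigr => j _; rewrite (lie_brMnr lie_br).
case: r => [|r]; first by rewrite big1 // => j _; rewrite mul0rn.
rewrite IHm (lie_br_sumr lie_br); apply: eq_bigr => j _.
by rewrite (lie_brMnr lie_br).
Qed.

Lemma sum_composition_bell r n N y : (n < N)%N ->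
  \sum_(t : r.-tuple 'I_N | is_composition n (map val t))
    foldr (fun m z => br (iter m.-1 (br u) x) z) y (map val t)
      *+ comp_coef (map val t) = bell r n y.
Proof.
elim: r n y => [|r IHr] n y lt_nN.
  rewrite (eq_bigl (fun t => (0%N == n) && (t == [tuple]))) => [|t]; last first.
    by rewrite tuple0 /is_composition /= eqxx andbT.
  case: n lt_nN => [|n] _ /=; last by rewrite big_pred0.
  by rewrite big_pred1_eq /= /comp_coef big_ord0 mulr1n.
rewrite (sum_composition_rcons (fun s =>
  foldr (fun m z => br (iter m.-1 (br u) x) z) y s)) //=.
apply: eq_bigr => i _; congr (_ *+ _).
rewrite -IHr; last first.
  by apply: leq_ltn_trans lt_nN; rewrite -subn1 -subnDA leq_subr.
by apply: eq_bigr => t _; rewrite foldr_rcons.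
Qed.

Lemma nested_br_rcons (s : seq g) z : nested_br br (rcons s z) = foldr br z s.
Proof. by elim: s => //= a s <-; case: s => [|b s]. Qed.

(** For y = x in [iter_poly_br_bell], the argument (ad u)^j x plays the part of a last entry j + 1
    of a composition; hence degree [r] in t goes with [r.+1] parts. *)
Lemma iter_poly_br_composition n r : (0 < n)%N ->
  iter n.-1 (poly_br br (poly_lin x u)) (poly_const x) r =
  \sum_(t : r.+1.-tuple 'I_n.+1 | is_composition n (map val t))
    nested_br br [seq iter m.-1 (br u) x | m <- map val t]
      *+ comp_coef (map val t).
Proof.
move=> n_gt0; rewrite iter_poly_br_bell.
rewrite (sum_composition_rcons (fun s =>
  nested_br br [seq iter m.-1 (br u) x | m <- s])) // prednK //.
apply: eq_bigr => i _; congr (_ *+ _).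
rewrite -(@sum_composition_bell _ _ n.+1); last first.
  by rewrite ltnS -subn1 -subnDA leq_subr.
apply: eq_bigr => t _; rewrite map_rcons nested_br_rcons.
by congr (_ *+ _); elim: (map val t) => //= a s ->.
Qed.

End NoncommutativeBell.

(** * The semidirect product and its p-map *)

Lemma pair_addE (V W : nmodType) (a c : V) (b d : W) :
  (a, b) + (c, d) = (a + c, b + d).
Proof. by []. Qed.

Lemma pair_scaleE (k : fieldType) (V W : lmodType k) (s : k) (a : V) (b : W) :
  s *: (a, b) = (s *: a, s *: b).
Proof. by []. Qed.

Section SemidirectProduct.
Variables (k : fieldType) (p : nat) (g : lmodType k) (lam : k).
Variables (br : g -> g -> g) (pm : g -> g).
Hypothesis char_k : p \in [pchar k].
Hypothesis restricted_g : is_restricted_lie_algebra p br pm.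

Let lie_br := restricted_lie restricted_g.

(* The first factor carries the bracket [lam *: br], the second one [br], and
   the second factor acts on the first one by [br]. *)
Definition sd_br (X Y : g * g) : g * g :=
  (lam *: br X.1 Y.1 + br X.2 Y.1 + br X.1 Y.2, br X.2 Y.2).

Lemma sd_br_lie : is_lie_algebra sd_br.
Proof.
split=> [[y v] a [x1 u1] [x2 u2]|[x u] a [y1 v1] [y2 v2]|[x u]|
         [x u] [y v] [z w]];
  rewrite /sd_br /= ?pair_scaleE ?pair_addE; congr pair.
- rewrite !(lie_linearl lie_br) !scalerDr !scalerA [lam * a]mulrC.
  by rewrite [X in X + _]addrACA [LHS]addrACA.
- by rewrite (lie_linearl lie_br).
- rewrite !(lie_linearr lie_br) !scalerDr !scalerA [lam * a]mulrC.
  by rewrite [X in X + _]addrACA [LHS]addrACA.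
- by rewrite (lie_linearr lie_br).
- by rewrite (lie_alternating lie_br) scaler0 add0r (lie_anticomm lie_br) addNr.
- by rewrite (lie_alternating lie_br).
(* The first component of a double bracket is sorted by powers of [lam]: [P] yields lam^2, [Q]
   yields lam and [T] the rest. The cyclic sums vanish power by power, once [rot] has aligned the
   triples with Jacobi identities in [g]. *)
- pose P (x1 u1 y1 v1 z1 w1 : g) := lam *: br x1 (br y1 z1).
  pose Q (x1 u1 y1 v1 z1 w1 : g) :=
    (br x1 (br v1 z1), br x1 (br y1 w1), br u1 (br y1 z1)).
  pose T (x1 u1 y1 v1 z1 w1 : g) :=
    (br u1 (br v1 z1), br u1 (br y1 w1), br x1 (br v1 w1)).
  pose s3 (t : g * g * g) := t.1.1 + t.1.2 + t.2.
  have expand (x1 u1 y1 v1 z1 w1 : g) :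
      lam *: br x1 (lam *: br y1 z1 + br v1 z1 + br y1 w1)
      + br u1 (lam *: br y1 z1 + br v1 z1 + br y1 w1) + br x1 (br v1 w1)
    = lam *: (P x1 u1 y1 v1 z1 w1 + s3 (Q x1 u1 y1 v1 z1 w1))
      + s3 (T x1 u1 y1 v1 z1 w1).
    rewrite !(lie_brDr lie_br) !(lie_brZr lie_br) /s3 /=.
    by rewrite !scalerDr !addrA.
  have regroup (a1 a2 b1 b2 c1 c2 : g) :
      (a1 + a2) + (b1 + b2) + (c1 + c2) = (a1 + b1 + c1) + (a2 + b2 + c2).
    by rewrite [X in X + _]addrACA [LHS]addrACA.
  have J := lie_jacobi lie_br.
  have s3E (a b c : g) : s3 (a, b, c) = a + b + c by [].
  have rot (a b c : g) : a + b + c = b + c + a by rewrite -addrA addrC.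
  rewrite !expand regroup -!scalerDr regroup -!scalerDr J scaler0 add0r.
  rewrite !s3E [X in _ *: (_ + X + _)]rot [X in _ *: (_ + X + _)]rot.
  rewrite [X in _ *: (_ + X)]rot [X in _ + (_ + X + _)]rot.
  rewrite [X in _ + (_ + X)]rot [X in _ + (_ + X)]rot.
  by do 4 rewrite regroup J; rewrite !J !(addr0, scaler0).
- by rewrite (lie_jacobi lie_br).
Qed.

Definition sd_pmap (X : g * g) : g * g :=
  (lam ^+ p.-1 *: pm X.1, 0) + (0, pm X.2)
  + jacobson_sum p sd_br (X.1, 0) (0, X.2).

Lemma sd_inl_linear : linear (fun x : g => (x, 0) : g * g).
Proof. by move=> a x y; congr pair; rewrite /= ?scaler0 ?addr0. Qed.

Lemma sd_inr_linear : linear (fun u : g => (0, u) : g * g).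
Proof. by move=> a x y; congr pair; rewrite /= ?scaler0 ?addr0. Qed.

Lemma sd_br_ll x y : sd_br (x, 0) (y, 0) = (lam *: br x y, 0).
Proof. by rewrite /sd_br /= !(lie_br0l lie_br) (lie_br0r lie_br) !addr0. Qed.

Lemma sd_br_rl u y : sd_br (0, u) (y, 0) = (br u y, 0).
Proof.
rewrite /sd_br /= !(lie_br0l lie_br) (lie_br0r lie_br) !addr0.
by rewrite scaler0 add0r.
Qed.

Lemma sd_br_rr u y v : sd_br (0, u) (y, v) = (br u y, br u v).
Proof. by rewrite /sd_br /= !(lie_br0l lie_br) scaler0 add0r addr0. Qed.

(** The first bracket lands in the ideal of pairs with second component 0, where each further
    bracket brings a factor [lam]. *)
Lemma iter_sd_br_l n x y v : iter n.+1 (sd_br (x, 0)) (y, v) =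
  (lam ^+ n *: (lam *: iter n.+1 (br x) y + iter n.+1 (br x) v), 0).
Proof.
elim: n => [|n IHn].
  by rewrite /sd_br /= !(lie_br0l lie_br) addr0 scale1r.
rewrite iterS IHn sd_br_ll (lie_brZr lie_br) scalerA -exprS.
by rewrite (lie_brDr lie_br) (lie_brZr lie_br).
Qed.

Lemma sd_restricted_l : is_restricted_on p sd_br
  (fun X => (X.1, 0)) (fun X => (lam ^+ p.-1 *: pm X.1, 0)).
Proof.
have p_gt0 := prime_gt0 (pcharf_prime char_k).
have [_ pZ _ pD] := scale_br_restricted lam char_k restricted_g.
split=> [a X Y|a [x u]|[x u] [y v]|[x u] [y v]] /=.
- exact: sd_inl_linear.
- by rewrite pZ (linear_funZ sd_inl_linear).
- rewrite -[p in RHS](prednK p_gt0) iter_sd_br_l prednK //.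
  rewrite /sd_br /= !(lie_br0l lie_br) !(lie_brZl lie_br) addr0.
  by rewrite !(pmap_ad restricted_g) scalerDr !scalerA [lam * _]mulrC.
- rewrite pD !(linear_funD sd_inl_linear); congr (_ + _).
  rewrite -/(jacobson_sum p (scale_br lam br) x y).
  apply: (hom_jacobson_sum p sd_inl_linear) => {}x {}y.
  by rewrite sd_br_ll.
Qed.

Lemma sd_restricted_r : is_restricted_on p sd_br
  (fun X => (0, X.2)) (fun X => (0, pm X.2)).
Proof.
have [_ pZ pad pD] := restricted_g.
split=> [a X Y|a [x u]|[x u] [y v]|[x u] [y v]] /=.
- exact: sd_inr_linear.
- by rewrite pZ (linear_funZ sd_inr_linear).
- rewrite sd_br_rr !pad; elim: p => //= n <-.
  by rewrite sd_br_rr.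
- rewrite pD !(linear_funD sd_inr_linear); congr (_ + _).
  apply: (hom_jacobson_sum p sd_inr_linear) => {}u {}v.
  by rewrite sd_br_rr (lie_br0r lie_br).
Qed.

Lemma sd_pmap_restricted : (exists2 s : k, s != 0 & s != 1) ->
  is_restricted_lie_algebra p sd_br sd_pmap.
Proof.
move=> k_big; apply: (restricted_decomposition char_k k_big sd_br_lie
  sd_restricted_l sd_restricted_r).
by case=> x u; congr pair; rewrite /= ?addr0 ?add0r.
Qed.

(** In the coefficient of t^(r-1), r - 1 of the p - 1 brackets are with (x, 0) and contribute [lam]
    each; those with (0, u) contribute none. *)
Lemma jacobson_sum_sd x u : jacobson_sum p sd_br (x, 0) (0, u) =
  (\sum_(1 <= r < p) ((r%:R : k)^-1 * lam ^+ r.-1) *: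
     iter p.-1 (poly_br br (poly_lin x u)) (poly_const x) r.-1, 0).
Proof.
rewrite (linear_fun_sum sd_inl_linear); apply: eq_bigr => r _.
rewrite -scalerA (linear_funZ sd_inl_linear); congr (_ *: _).
elim: p.-1 (r.-1) => [|n IHn] i /=.
  by case: i => [|i] /=; rewrite ?scale1r ?scaler0.
rewrite (poly_br_linE sd_br_lie) (poly_br_linE lie_br) IHn sd_br_rl.
rewrite (lie_brZr lie_br) scalerDr; case: i => [|i].
  by rewrite scaler0 !addr0.
rewrite IHn sd_br_ll pair_addE addr0 (lie_brZr lie_br).
by rewrite scalerA -exprS.
Qed.

End SemidirectProduct.

(** * The descendent p-map, its naturality and the conclusion *)

Lemma desc_pmapE (k : fieldType) (p : nat) (g : lmodType k) (lam : k)
    (br : g -> g -> g) (pm R : g -> g) x :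
    is_lie_algebra br -> (0 < p)%N ->
  desc_pmap p lam br pm R x = lam ^+ p.-1 *: pm x +
    \sum_(1 <= r < p) ((r%:R : k)^-1 * lam ^+ r.-1) *:
      iter p.-1 (poly_br br (poly_lin x (R x))) (poly_const x) r.-1.
Proof.
(* The compositions of length r make up the coefficient of t^(r-1) in (ad (t x + R x))^(p-1) x. *)
move=> lie_br p_gt0; congr (_ + _); apply: eq_big_nat => -[|r] // _.
by rewrite (iter_poly_br_composition _ _ lie_br).
Qed.

Section DescPmapHom.
Variables (k : fieldType) (p : nat) (g h : lmodType k) (lam : k).
Variables (brg : g -> g -> g) (pmg Rg : g -> g).
Variables (brh : h -> h -> h) (pmh Rh : h -> h) (f : g -> h).
Hypothesis hom_f : is_restricted_rota_baxter_hom brg pmg Rg brh pmh Rh f.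

Lemma hom_nested_br s : f (nested_br brg s) = nested_br brh (map f s).
Proof.
elim: s => [|x [|y s] IHs] //=; first exact: linear_fun0 (hom_linear hom_f).
by rewrite (hom_br hom_f) IHs.
Qed.

(** Naturality of the construction. Taken for [R] as a map out of the descendent algebra, it is the
    condition that [R] carries the p-map of the second descent to that of the first. *)
Lemma hom_desc_pmap x :
  f (desc_pmap p lam brg pmg Rg x) = desc_pmap p lam brh pmh Rh (f x).
Proof.
have fL := hom_linear hom_f.
rewrite /desc_pmap (linear_funD fL) (linear_funZ fL) (hom_pmap hom_f).
congr (_ + _); rewrite (linear_fun_sum fL); apply: eq_bigr => r _.
rewrite (linear_funZ fL) (linear_fun_sum fL); congr (_ *: _).
apply: eq_bigr => t _; rewrite -!scaler_nat (linear_funZ fL) hom_nested_br.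
congr (_ *: nested_br _ _); rewrite -map_comp; apply: eq_map => m /=.
by rewrite /rhd_pow (hom_iter_br (hom_br hom_f)) (hom_rb hom_f).
Qed.

End DescPmapHom.

Lemma closed_field_neq01 (k : closedFieldType) : exists2 s : k, s != 0 & s != 1.
Proof.
(* A root of X^2 = 1 + X is neither 0 nor 1 in any characteristic. *)
have [//|s] := @solve_monicpoly k 2 (fun=> 1).
rewrite big_ord_recl big_ord1 /= !mul1r expr0 expr1 => s2E; exists s.
  apply/eqP => s0; move/eqP: s2E.
  by rewrite s0 expr0n addr0 eq_sym oner_eq0.
apply/eqP => s1; move/eqP: s2E.
by rewrite s1 expr1n -subr_eq0 opprD addNKr oppr_eq0 oner_eq0.
Qed.

Theorem theorem4p10 (k : closedFieldType) (p : nat) (char_k : p \in [pchar k])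
    (g : lmodType k) (lam : k) (br : g -> g -> g) (pm R : g -> g)
    (rrb_g : is_restricted_rota_baxter p lam br pm R) :
  is_restricted_rota_baxter p lam
    (desc_br lam br R) (desc_pmap p lam br pm R) R
  /\ is_restricted_rota_baxter_hom
       (desc_br lam br R) (desc_pmap p lam br pm R) R
       br pm R
       R.
Proof.
have p_gt0 := prime_gt0 (pcharf_prime char_k).
have [res_g R_linear rb_R R_pm] := rrb_g; have lie_br := restricted_lie res_g.
have R_br x y : R (desc_br lam br R x y) = br (R x) (R y).
  by rewrite rb_R !(linear_funD R_linear) (linear_funZ R_linear).
(* This concerns the operations only, so it is available before the descendent algebra is known to
   be restricted. *)
have R_hom : is_restricted_rota_baxter_hom
    (desc_br lam br R) (desc_pmap p lam br pm R) R br pm R R by split.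
split=> //; split=> //; last by move=> x; exact: (hom_desc_pmap p lam R_hom).
(* The graph of [R] embeds the descendent algebra: the first component of the bracket is [desc_br]
   by definition, the second is the Rota-Baxter identity. *)
- apply: (restricted_pullback (f := fun x => (x, R x)) _ _ _
    (sd_pmap_restricted lam char_k res_g (closed_field_neq01 k))).
  + by move=> a x y; rewrite R_linear.
  + by move=> x y; rewrite R_br /sd_br /= /desc_br addrC addrA.
  + by move=> x y [].
  + move=> x; rewrite /sd_pmap (jacobson_sum_sd lam res_g) R_pm.
    by rewrite (desc_pmapE _ _ _ _ lie_br) // !pair_addE !addr0 add0r.
- by move=> x y; rewrite !R_br.
Qed.
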